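(* Let $\tau=\frac14\sqrt{\frac16\left(111-\sqrt{33}\right)}\approx 1.047$. For every positive integer $n$ there exists an $n$-dimensional body of constant width $K\subset\mathbb{R}^n$ whose illumination number is at least $(\tau+o(1))^n$, where $o(1)$ denotes a quantity depending only on $n$ that tends to $0$ as $n\to\infty$. That is, there is a real sequence $(\varepsilon_n)_{n\ge 1}$ with $\varepsilon_n\to 0$ such that for every positive integer $n$ there is a body of constant width $K\subset\mathbb{R}^n$ with illumination number at least $(\tau+\varepsilon_n)^n$.
   Context: A convex body in $\mathbb{R}^n$ is a compact convex set with nonempty interior. A convex body has constant width if the distance between its two parallel supporting hyperplanes orthogonal to a unit vector $u$ is the same for all unit vectors $u$. A boundary point $x$ of a convex body $B\subset\mathbb{R}^n$ is illuminated by a direction (unit vector) $\ell$ if the ray from $x$ in the direction of $\ell$ intersects the interior of $B$, i.e. $x+t\ell\in\operatorname{int}B$ for some $t>0$. A set of directions $\mathcal{L}$ illuminates $B$ if each boundary point of $B$ is illuminated by some direction in $\mathcal{L}$. The illumination number of $B$ is the minimal size of a set of directions illuminating $B$. *)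

(* Defs.v *)
From HB Require Import structures.
From mathcomp Require Export all_boot all_order all_algebra.
From mathcomp Require Export all_classical all_reals all_analysis.
Set Implicit Arguments.
Unset Strict Implicit.
Unset Printing Implicit Defensive.
Export Order.TTheory GRing.Theory Num.Theory.
Export numFieldNormedType.Exports.
Local Open Scope classical_set_scope.
Local Open Scope ring_scope.

(* Points of R^n are row vectors. The library norm on matrices is the sup norm,
   so the Euclidean structure is defined here; both norms induce the same
   topology, hence the library's [compact] and [interior] can be used as is. *)
Definition dotv (R : realType) (n : nat) (x y : 'rV[R]_n) : R :=
  \sum_i x 0 i * y 0 i.

Definition enorm (R : realType) (n : nat) (x : 'rV[R]_n) : R :=
  Num.sqrt (dotv x x).

Definition unit_vector (R : realType) (n : nat) (u : 'rV[R]_n) : Prop :=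
  enorm u = 1.

Definition convex_body (R : realType) (n : nat) (B : set 'rV[R]_n) : Prop :=
  [/\ compact B, convex_set (B : set (convex_lmodType 'rV[R]_n)) & interior B !=set0].

Definition supporting_hyperplane (R : realType) (n : nat)
    (B : set 'rV[R]_n) (u : 'rV[R]_n) (H : set 'rV[R]_n) : Prop :=
  exists c : R,
    [/\ H = [set x | dotv u x = c],
        B `&` H !=set0
      & B `<=` [set x | dotv u x <= c] \/ B `<=` [set x | c <= dotv u x]].

Definition set_distance (R : realType) (n : nat) (A B : set 'rV[R]_n) : R :=
  inf [set enorm (x - y) | x in A & y in B].

(* A convex body has exactly two supporting hyperplanes orthogonal to a given
   unit vector, so [H1] and [H2] below are uniquely determined up to order. *)
Definition constant_width (R : realType) (n : nat) (B : set 'rV[R]_n) : Prop :=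
  exists w : R, forall u : 'rV[R]_n, unit_vector u ->
    exists H1 H2 : set 'rV[R]_n,
      [/\ supporting_hyperplane B u H1, supporting_hyperplane B u H2,
          H1 <> H2 & set_distance H1 H2 = w].

Definition illuminated_by (R : realType) (n : nat)
    (B : set 'rV[R]_n) (x l : 'rV[R]_n) : Prop :=
  exists2 t : R, 0 < t & interior B (x + t *: l).

Definition illuminates (R : realType) (n : nat)
    (L B : set 'rV[R]_n) : Prop :=
  forall x, (closure B `\` interior B) x ->
    exists2 l, L l & illuminated_by B x l.

(* [counting L] is the number of elements of [L], or +oo if [L] is infinite;
   an infimum of such values over a nonempty family is attained. *)
Definition illumination_number (R : realType) (n : nat)
    (B : set 'rV[R]_n) : \bar R :=
  ereal_inf [set counting L | L in
    [set L : set 'rV[R]_n | L `<=` @unit_vector R n /\ illuminates L B]].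

Definition tau (R : realType) : R :=
  4^-1 * Num.sqrt (6^-1 * (111 - Num.sqrt 33)).

(* Main.v *)
Require Import Defs.
From mathcomp Require Import finmap ring lra.
Set Implicit Arguments.
Unset Strict Implicit.
Unset Printing Implicit Defensive.
Local Open Scope classical_set_scope.
Local Open Scope ring_scope.

(** If [x] and [y] are points of a body of constant width [w] at distance [w],
    then the body lies in the ball of radius [w] around [y], so a direction
    that illuminates [x] makes an acute angle with [y - x].  A boundary point
    with many such partners [y] is therefore hard to illuminate.

    For a unit vector [a], the point [apex s a] = (1 - 2s)a has all the points
    [rim_point s w a v] = -sa + swv as partners, where [v] runs over the unit
    vectors orthogonal to [a]; the acute angle conditions then say that an
    illuminating direction [l] satisfies <l, -a> > s, i.e. lies in a cap
    ([cap_of_rim_directions]).  Take such a cone-like figure for every vector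
    [a] of a code, a finite set of unit vectors whose mutual inner products
    have absolute value at most [s].  If 8 s^2 + s = 1 and
    (1 + s) w^2 = 1 - s, all these figures together still have diameter [w].
    A set of diameter [w] is contained in a maximal one
    ([exists_completion]), and a maximal one has constant width
    ([complete_convex_body]).  Hence the illumination number is at least the
    size of the code divided by the maximal number of its vectors in a cap
    {a | <l, a> > s}.

    It remains to find a code of size about (1 - s^2)^(-n/2) with polynomially
    many vectors in every cap ([exists_code]); as s = (sqrt 33 - 1) / 16, one
    has (1 - s^2)^(-1/2) = tau.  A random code would do, because a cap has
    relative measure about (1 - s^2)^(n/2).  Uniform measure on the sphere is
    replaced by a finite set of grid points, contained in a ball of radius
    [M], such that every ball of radius sigma M contains at most a fraction
    sigma'^n of its points, sigma' being slightly larger than sigma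
    ([exists_sparse_set]).  This is enough because a cone
    s |x| <= <x, l> cut off at |x| <= M fits into a ball of radius
    sqrt (1 - s^2) M ([cone_sub_ball]).  The random choice is replaced by a
    greedy one that controls the sum of 2^(number of chosen points in the cap)
    over a finite net of caps ([greedy_selection]). *)

(** * Euclidean inner product and norm *)

Section Euclidean.
Context {R : realType} {n : nat}.
Implicit Types x y z : 'rV[R]_n.

Lemma dotvC x y : dotv x y = dotv y x.
Proof. by apply: eq_bigr => i _; rewrite mulrC. Qed.

Lemma dotvDl x y z : dotv (x + y) z = dotv x z + dotv y z.
Proof.
by rewrite /dotv -big_split; apply: eq_bigr => i _; rewrite mxE mulrDl.
Qed.

Lemma dotvZl a x y : dotv (a *: x) y = a * dotv x y.
Proof.
by rewrite /dotv mulr_sumr; apply: eq_bigr => i _; rewrite mxE mulrA.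
Qed.

Lemma dotvDr x y z : dotv x (y + z) = dotv x y + dotv x z.
Proof. by rewrite dotvC dotvDl !(dotvC x). Qed.

Lemma dotvZr a x y : dotv x (a *: y) = a * dotv x y.
Proof. by rewrite dotvC dotvZl dotvC. Qed.

Lemma dotvNl x y : dotv (- x) y = - dotv x y.
Proof. by rewrite -scaleN1r dotvZl mulN1r. Qed.

Lemma dotvNr x y : dotv x (- y) = - dotv x y.
Proof. by rewrite dotvC dotvNl dotvC. Qed.

Definition dotvE := (dotvDl, dotvDr, dotvNl, dotvNr, dotvZl, dotvZr).

Lemma dotv_ge0 x : 0 <= dotv x x.
Proof. by apply: sumr_ge0 => i _; rewrite -expr2 sqr_ge0. Qed.

Lemma sqr_coord_le x i : x 0 i ^+ 2 <= dotv x x.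
Proof.
rewrite /dotv (bigD1 i)//= -expr2 lerDl.
by apply: sumr_ge0 => j _; rewrite -expr2 sqr_ge0.
Qed.

Lemma dotv_eq0 x : dotv x x = 0 -> x = 0.
Proof.
move=> x0; apply/rowP => i; rewrite mxE; apply/eqP; rewrite -sqrf_eq0 eq_le.
by rewrite sqr_ge0 andbT -x0 sqr_coord_le.
Qed.

Lemma dotv0l x : dotv 0 x = 0.
Proof. by rewrite -(scale0r x) dotvZl mul0r. Qed.

Lemma sqr_enorm x : enorm x ^+ 2 = dotv x x.
Proof. by rewrite sqr_sqrtr ?dotv_ge0. Qed.

Lemma enorm_ge0 x : 0 <= enorm x. Proof. exact: sqrtr_ge0. Qed.

Lemma enorm_eq0 x : enorm x = 0 -> x = 0.
Proof. by move=> x0; apply: dotv_eq0; rewrite -sqr_enorm x0 expr0n. Qed.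

Lemma enorm_le x r : 0 <= r -> (enorm x <= r) = (dotv x x <= r ^+ 2).
Proof. by move=> r0; rewrite -sqr_enorm ler_pXn2r ?nnegrE ?enorm_ge0. Qed.

Lemma enorm_lt x r : 0 <= r -> (enorm x < r) = (dotv x x < r ^+ 2).
Proof. by move=> r0; rewrite -sqr_enorm ltr_pXn2r ?nnegrE ?enorm_ge0. Qed.

Lemma enormZ a x : enorm (a *: x) = `|a| * enorm x.
Proof.
by rewrite /enorm !dotvE mulrA -expr2 sqrtrM ?sqr_ge0// sqrtr_sqr.
Qed.

Lemma enormN x : enorm (- x) = enorm x.
Proof. by rewrite -scaleN1r enormZ normrN1 mul1r. Qed.

Lemma enormB x y : enorm (x - y) = enorm (y - x).
Proof. by rewrite -enormN opprB. Qed.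

Lemma enorm0 : enorm (0 : 'rV[R]_n) = 0.
Proof. by rewrite /enorm dotv0l sqrtr0. Qed.

Lemma unit_vectorP x : unit_vector x <-> dotv x x = 1.
Proof.
split=> [x1|x1]; first by rewrite -sqr_enorm x1 expr1n.
by rewrite /unit_vector /enorm x1 sqrtr1.
Qed.

Lemma Cauchy_Schwarz x y : dotv x y ^+ 2 <= dotv x x * dotv y y.
Proof.
have [y0|y0] := eqVneq (dotv y y) 0.
  by rewrite (dotv_eq0 y0) dotvC !dotv0l expr0n mulr0.
have yp : 0 < dotv y y by rewrite lt_neqAle eq_sym y0 dotv_ge0.
have := dotv_ge0 (dotv y y *: x - dotv x y *: y).
rewrite !dotvE (dotvC y x) => h.
rewrite -subr_ge0 -(pmulr_rge0 _ yp).
by apply: le_trans h _; rewrite le_eqVlt; apply/orP; left; apply/eqP; ring.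
Qed.

Lemma dotv_le_enorm x y : dotv x y <= enorm x * enorm y.
Proof.
have [h|h] := leP (dotv x y) 0.
  by rewrite (le_trans h)// mulr_ge0 ?enorm_ge0.
rewrite -(@ler_pXn2r _ 2) ?nnegrE ?mulr_ge0 ?enorm_ge0 ?(ltW h)//.
by rewrite exprMn !sqr_enorm Cauchy_Schwarz.
Qed.

Lemma enormD x y : enorm (x + y) <= enorm x + enorm y.
Proof.
rewrite enorm_le ?addr_ge0 ?enorm_ge0// !dotvE sqrrD !sqr_enorm (dotvC y x).
have := dotv_le_enorm x y; lra.
Qed.

Lemma coord_le_enorm x i : `|x 0 i| <= enorm x.
Proof.
rewrite -(@ler_pXn2r _ 2) ?nnegrE ?enorm_ge0// real_normK ?num_real//.
by rewrite sqr_enorm sqr_coord_le.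
Qed.

Lemma enorm_le_coord x r : 0 <= r -> (forall i, `|x 0 i| <= r) ->
  enorm x <= n%:R * r.
Proof.
move=> r0 xr; rewrite enorm_le ?mulr_ge0// exprMn.
apply: (@le_trans _ _ (n%:R * r ^+ 2)).
  rewrite mulr_natl -[X in _ *+ X]card_ord -sumr_const; apply: ler_sum => i _.
  by rewrite -expr2 -[leLHS]real_normK ?num_real// ler_pXn2r ?nnegrE.
rewrite ler_wpM2r ?sqr_ge0// -natrX ler_nat.
by case: (n) => // k; rewrite leq_pmulr.
Qed.

End Euclidean.

(** * Finite sets that are sparse in smaller balls *)

Section Sparse.
Context {R : realType}.

Lemma Bernoulli (h : R) k : 0 <= h -> 1 + k%:R * h <= (1 + h) ^+ k.
Proof.
move=> h0; elim: k => [|k ih]; first by rewrite mul0r addr0 expr0.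
rewrite exprS; apply: (@le_trans _ _ ((1 + h) * (1 + k%:R * h))); last first.
  by rewrite ler_wpM2l ?addr_ge0.
have : 0 <= k%:R * h * h by rewrite !mulr_ge0.
rewrite -natr1; nra.
Qed.

Lemma exists_expr_gt (r A : R) : 1 < r -> exists k, A < r ^+ k.
Proof.
move=> r1; have h0 : 0 < r - 1 by rewrite subr_gt0.
exists (Num.truncn (A / (r - 1))).+1.
have -> : r = 1 + (r - 1) by ring.
apply: lt_le_trans (Bernoulli _ (ltW h0)).
have -> : 1 + (r - 1) - 1 = r - 1 by ring.
have := truncnS_gt (A / (r - 1)); rewrite ltr_pdivrMr//; lra.
Qed.

Context {n : nat}.

Definition grid_point m (z : {ffun 'I_n -> 'I_m}) : 'rV[R]_n :=
  \row_i (z i)%:R.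

Lemma grid_point_sep m (z z' : {ffun 'I_n -> 'I_m}) :
  z != z' -> 1 <= enorm (grid_point z - grid_point z').
Proof.
move=> zz'; have [i zi] : exists i, z i != z' i.
  by apply/existsP; rewrite -negb_forall; apply: contra zz' => /forallP h;
     apply/eqP/ffunP => i; apply/eqP/h.
apply: le_trans (coord_le_enorm _ i); rewrite !mxE.
move: zi; rewrite -val_eqE/= neq_lt => /orP[h|h].
  by rewrite distrC -natrB ?(ltnW h)// normr_nat ler1n subn_gt0.
by rewrite -natrB ?(ltnW h)// normr_nat ler1n subn_gt0.
Qed.

(** Start with a full cube of grid points.  If some ball of the smaller radius
    always held more than the fraction [sigma' ^+ n], passing to it again and
    again would, after [k] rounds, leave at least [(sigma' ^+ k * m) ^+ n]
    points in a ball of radius [sigma ^+ k * n * m].  For a suitable side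
    length [m], that is more than one point of the grid in a ball of diameter
    less than 1. *)
Lemma exists_sparse_set (sigma sigma' : R) :
  (0 < n)%N -> 0 < sigma -> sigma < sigma' -> sigma' <= 1 ->
  exists m (c : 'rV[R]_n) (M : R) (Om : {set {ffun 'I_n -> 'I_m}}),
    [/\ 0 < M, (0 < #|Om|)%N,
        forall z, z \in Om -> enorm (grid_point z - c) <= M &
        forall c', #|[set z in Om | enorm (grid_point z - c') <= sigma * M]%SET|%:R
                   <= sigma' ^+ n * #|Om|%:R].
Proof.
move=> n0 s0 ss' s'1; have s'0 : 0 < sigma' by apply: lt_trans ss'.
(* [k] and [m] are chosen so that sigma'^k m > 1 and 2 sigma^k n m < 1. *)
have [k kP] : exists k, 4 * n%:R < (sigma' / sigma) ^+ k.
  by apply: exists_expr_gt; rewrite ltr_pdivlMr ?mul1r.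
pose m := (Num.truncn (sigma' ^- k)).+1.
have mgt : sigma' ^- k < m%:R by apply: truncnS_gt.
have mle : m%:R <= 2 * sigma' ^- k.
  have i0 : 0 <= sigma' ^- k by rewrite invr_ge0 exprn_ge0// ltW.
  rewrite /m -natr1 mulr_natl mulr2n lerD//; first by case/andP: (truncn_itv i0).
  by rewrite invf_ge1 ?exprn_gt0// exprn_ile1// ltW.
pose M0 : R := n%:R * m%:R.
have M00 : 0 < M0 by rewrite mulr_gt0 ?ltr0n.
apply: contrapT => noset.
have descent j : exists (c : 'rV[R]_n) (Om : {set {ffun 'I_n -> 'I_m}}),
    (forall z, z \in Om -> enorm (grid_point z - c) <= sigma ^+ j * M0) /\
    (sigma' ^+ j * m%:R) ^+ n <= #|Om|%:R.
  elim: j => [|j [c [Om [Omc Omn]]]].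
    exists 0, [set: {ffun 'I_n -> 'I_m}]%SET; split => [z _|].
      rewrite subr0 mul1r; apply: enorm_le_coord => // i.
      by rewrite mxE normr_nat ler_nat ltnW.
    by rewrite mul1r cardsT card_ffun !card_ord natrX.
  have Om0 : (0 < #|Om|)%N.
    rewrite -(ltr_nat R); apply: lt_le_trans Omn.
    by rewrite exprn_gt0// mulr_gt0 ?exprn_gt0 ?ltr0n.
  apply: contrapT => noj; apply: noset.
  exists m, c, (sigma ^+ j * M0), Om; split=> //.
    by rewrite mulr_gt0// exprn_gt0.
  move=> c'; rewrite leNgt; apply/negP => big; apply: noj.
  exists c', [set z in Om | enorm (grid_point z - c') <= sigma * (sigma ^+ j * M0)]%SET.
  split=> [z|]; first by rewrite inE exprS mulrA => /andP[].
  apply/(le_trans _ (ltW big)); rewrite exprS -mulrA exprMn.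
  by rewrite ler_wpM2l ?exprn_ge0// ltW.
have [c [Om [Omc Omn]]] := descent k.
have : (1 < #|Om|)%N.
  rewrite -(ltr_nat R); apply: lt_le_trans Omn.
  by rewrite exprn_egt1 -?lt0n// mulrC -ltr_pdivrMr ?exprn_gt0// mul1r.
case/card_gt1P => z [z' [zOm z'Om zz']].
have := grid_point_sep zz'; apply/negP; rewrite -ltNge.
have -> : grid_point z - grid_point z' =
    (grid_point z - c) + (c - grid_point z').
  by rewrite addrA subrK.
apply: le_lt_trans (enormD _ _) _; rewrite (enormB c).
apply: (@le_lt_trans _ _ (2 * (sigma ^+ k * M0))).
  by rewrite mulr_natl mulr2n lerD// Omc.
have sk : 0 < sigma ^+ k by rewrite exprn_gt0.
have s'k : 0 < sigma' ^+ k by rewrite exprn_gt0.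
apply: (@le_lt_trans _ _ (2 * (sigma ^+ k * (n%:R * (2 * sigma' ^- k))))).
  by rewrite ler_pM2l// ler_pM2l// ler_pM2l// ltr0n.
move: kP; rewrite expr_div_n ltr_pdivlMr// => kP.
have -> : 2 * (sigma ^+ k * (n%:R * (2 * sigma' ^- k))) =
  4 * n%:R * sigma ^+ k / sigma' ^+ k by ring.
by rewrite ltr_pdivrMr// mul1r.
Qed.

End Sparse.

(** * Greedy selection with few points in every cap *)

Section Greedy.
Context {R : realType} {T I : finType}.
Variables (Om Z : {set T}) (cap : I -> {set T}) (conf : T -> {set T}) (p : R).

Hypothesis Om_gt0 : (0 < #|Om|)%N.
Hypothesis p_ge0 : 0 <= p.
Hypothesis cap_le : forall i, #|Om :&: cap i|%:R <= p * #|Om|%:R.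
Hypothesis Z_le : #|Om :&: Z|%:R <= p * #|Om|%:R.
Hypothesis conf_le : forall x, x \in Om :\: Z ->
  #|Om :&: conf x|%:R <= 2 * p * #|Om|%:R.

Definition blocked (s : seq T) : {set T} := foldr (fun y B => conf y :|: B) Z s.

(** Exponential potential: it is at least [2 ^ c] if some cap contains [c] points
    of [s], and it grows slowly if the next point is chosen well. *)
Definition weight (s : seq T) : R := \sum_i 2 ^+ count (mem (cap i)) s.

Lemma blocked_le s : all (mem (Om :\: Z)) s ->
  #|Om :&: blocked s|%:R <= (1 + 2 * (size s)%:R) * p * #|Om|%:R.
Proof.
elim: s => [_|y s ih /= /andP[yOm /ih{}ih]].
  by rewrite mulr0 addr0 mul1r.
apply: (@le_trans _ _ (#|Om :&: conf y|%:R + #|Om :&: blocked s|%:R)).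
  by rewrite -natrD ler_nat finset.setIUr leq_card_setU.
apply: le_trans (lerD (conf_le yOm) ih) _; rewrite -natr1; lra.
Qed.

Lemma notin_blocked s x : x \notin blocked s ->
  x \notin Z /\ all (fun y => x \notin conf y) s.
Proof.
elim: s => [|y s ih] //=; rewrite finset.in_setU negb_or => /andP[-> /ih[? ->]].
by [].
Qed.

(** A new point doubles the terms of the caps that contain it.  Each cap
    contains at most [p * #|Om|] points of [Om], hence at most [2 * p * #|A|]
    points of [A], which has at least half the size of [Om]. *)
Lemma weight_average (A : {set T}) s :
  A \subset Om -> #|Om|%:R <= 2 * #|A|%:R :> R ->
  \sum_(x in A) weight (x :: s) <= #|A|%:R * ((1 + 2 * p) * weight s).
Proof.
move=> AOm OmA; rewrite exchange_big/= !mulr_sumr; apply: ler_sum => i _ /=.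
under eq_bigr do rewrite exprD.
rewrite -mulr_suml mulrA ler_wpM2r ?exprn_ge0//.
have -> : \sum_(x in A) (2 ^+ (x \in cap i) : R)
    = #|A|%:R + #|A :&: cap i|%:R.
  rewrite -!sum1_card !natr_sum.
  have -> : \sum_(x in A :&: cap i) (1%:R : R) = \sum_(x in A) (x \in cap i)%:R.
    rewrite [RHS]big_mkcond [LHS]big_mkcond; apply: eq_bigr => x _.
    by rewrite inE; case: (x \in A); case: (x \in cap i).
  rewrite -big_split; apply: eq_bigr => x _.
  by case: (x \in cap i); rewrite /= ?expr1 ?expr0 ?addr0.
apply: (@le_trans _ _ (#|A|%:R + p * #|Om|%:R)).
  rewrite lerD2l; apply: le_trans (cap_le i).
  by rewrite ler_nat subset_leq_card// finset.setSI.
have := ler_wpM2l p_ge0 OmA; lra.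
Qed.

(** While fewer than [N] points are chosen, at most half of [Om] is blocked by
    [Z] and by conflicts with the points chosen so far, and a best free point
    multiplies the weight by at most [1 + 2 * p].  So the weight at most
    doubles in the whole process, since [2 * p * N <= 1 / 2]. *)
Lemma greedy_selection N : 4 * p * N%:R <= 1 ->
  exists s : seq T,
    [/\ size s = N, all (mem (Om :\: Z)) s,
        pairwise (fun x y => x \notin conf y) s &
        forall i, (2 ^ count (mem (cap i)) s <= 2 * #|I|)%N].
Proof.
move=> pN.
suff [s [ss sOm sp sw]] : exists s : seq T,
    [/\ size s = N, all (mem (Om :\: Z)) s,
        pairwise (fun x y => x \notin conf y) s &
        weight s * (1 - 2 * p * N%:R) <= #|I|%:R].
  exists s; split=> // i; rewrite -(ler_nat R) natrX natrM.
  have w0 j : 0 <= (2 : R) ^+ count (mem (cap j)) s by rewrite exprn_ge0.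
  have : 2 ^+ count (mem (cap i)) s <= weight s.
    by rewrite /weight (bigD1 i)//= lerDl sumr_ge0.
  have : 0 <= weight s by apply: sumr_ge0.
  nra.
elim: N pN => [|N ih] pN.
  exists [::]; split => //; rewrite mulr0 subr0 mulr1 /weight/=.
  by rewrite (eq_bigr (fun=> 1)) ?sumr_const ?cardT// => i _; rewrite expr0.
have pS : 4 * p * N%:R + 4 * p <= 1 by move: pN; rewrite -natr1; lra.
have [|s [ss sOm sp sw]] := ih.
  by have := p_ge0; move: pS; set u := 4 * p * N%:R; lra.
pose A := Om :\: blocked s.
have OmA : #|Om|%:R <= 2 * #|A|%:R :> R.
  have := blocked_le sOm; rewrite ss => bs.
  have -> : #|Om|%:R = #|Om :&: blocked s|%:R + #|A|%:R :> R.
    by rewrite -natrD cardsID.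
  have : #|Om|%:R = #|Om :&: blocked s|%:R + #|A|%:R :> R.
    by rewrite -natrD cardsID.
  have : (0 : R) <= #|Om|%:R by [].
  have := ler_wpM2r (ler0n R #|Om|) pS.
  have : 0 <= p * #|Om|%:R by rewrite mulr_ge0.
  lra.
have A0 : (0 < #|A|)%N.
  rewrite -(ltr_nat R).
  have : (0 : R) < #|Om|%:R by rewrite ltr0n.
  lra.
have [x xA xw] : exists2 x, x \in A & weight (x :: s) <= (1 + 2 * p) * weight s.
  apply: contrapT => nox.
  have := weight_average s (finset.subsetDl _ _) OmA; apply/negP; rewrite -ltNge.
  rewrite mulr_natl -sumr_const; apply: ltr_sum.
    by case/card_gt0P : A0 => x xA; apply/hasP; exists x.
  by move=> x xA; rewrite ltNge; apply/negP => xw; apply: nox; exists x.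
move: (xA); rewrite inE => /andP[/notin_blocked[xZ xs] xOm].
exists (x :: s); split; rewrite /= ?ss ?sp ?andbT//.
  by rewrite sOm andbT inE xZ.
have w0 : 0 <= weight s by apply: sumr_ge0 => j _; rewrite exprn_ge0.
apply: le_trans _ sw.
apply: (@le_trans _ _ ((1 + 2 * p) * weight s * (1 - 2 * p * N.+1%:R))).
  by rewrite ler_wpM2r// -natr1; lra.
have -> : (1 + 2 * p) * weight s * (1 - 2 * p * N.+1%:R)
  = weight s * ((1 + 2 * p) * (1 - 2 * p * N.+1%:R)) by ring.
rewrite ler_wpM2l//.
have : 0 <= p * p * N%:R by rewrite !mulr_ge0.
have := mulr_ge0 p_ge0 p_ge0.
rewrite -natr1; lra.
Qed.

End Greedy.

(** * Spherical codes with few vectors in every cap *)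

Section Code.
Context {R : realType} {n : nat}.
Implicit Types x l : 'rV[R]_n.

Lemma unit_delta_mx (i : 'I_n) : unit_vector (delta_mx 0 i : 'rV[R]_n).
Proof.
apply/unit_vectorP; rewrite /dotv (bigD1 i)//= big1 => [|j ji].
  by rewrite !mxE !eqxx mul1r addr0.
by rewrite !mxE (negPf ji) andbF mul0r.
Qed.

Lemma unit_normalize x : x != 0 -> unit_vector ((enorm x)^-1 *: x).
Proof.
move=> x0; rewrite /unit_vector enormZ ger0_norm ?invr_ge0 ?enorm_ge0//.
by rewrite mulVf//; apply: contra_neq x0 => /enorm_eq0.
Qed.

(** Expanding, |x - sMl|^2 <= r^2 - 2 s^2 M r + s^2 M^2 with [r = enorm x], and
    this convex function of [r] is at most (1 - s^2) M^2 at both ends of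
    [0 <= r <= M], at [r = 0] because 2 s^2 <= 1. *)
Lemma cone_sub_ball x l (M s : R) : unit_vector l -> 0 <= s ->
  2 * s ^+ 2 <= 1 -> enorm x <= M -> s * enorm x <= dotv x l ->
  enorm (x - (s * M) *: l) <= Num.sqrt (1 - s ^+ 2) * M.
Proof.
move=> /unit_vectorP l1 s0 s2 xM sx.
have M0 : 0 <= M by apply: le_trans xM; apply: enorm_ge0.
rewrite enorm_le ?mulr_ge0 ?sqrtr_ge0// exprMn sqr_sqrtr; last by lra.
rewrite !dotvE l1 (dotvC l x) -sqr_enorm; move: sx xM (enorm_ge0 x).
set r := enorm x; set d := dotv x l => sx xM r0.
have h : s * M * (s * r) <= s * M * d by rewrite ler_wpM2l ?mulr_ge0.
have h2 : 0 <= (M - r) * (r + M - 2 * s ^+ 2 * M).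
  rewrite mulr_ge0 ?subr_ge0//.
  have : 2 * s ^+ 2 * M <= 1 * M by rewrite ler_wpM2r.
  lra.
rewrite expr2 in h2 *; nra.
Qed.

(** The cells of a partition of the cube [-1, 1]^n into [m.+1 ^ n] boxes of
    side at most [2 / m]; they provide a finite net of the unit sphere. *)
Definition cell m l : {ffun 'I_n -> 'I_m.+1} :=
  [ffun i => inord (Num.truncn ((l 0 i + 1) / 2 * m%:R))].

Lemma cell_close m l l' : (0 < m)%N -> unit_vector l -> unit_vector l' ->
  cell m l = cell m l' -> enorm (l - l') <= n%:R * (2 / m%:R).
Proof.
move=> m0 ul ul' cc; have m0' : (0 : R) < m%:R by rewrite ltr0n.
apply: enorm_le_coord => [|i]; first by rewrite divr_ge0.
have bound (v : 'rV[R]_n) : unit_vector v -> 0 <= (v 0 i + 1) / 2 * m%:R <= m%:R.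
  move=> uv; have := coord_le_enorm v i; rewrite uv ler_norml => /andP[a b].
  rewrite pmulr_lge0// ger_pMl//. apply/andP; split; lra.
have itv (v : 'rV[R]_n) : unit_vector v ->
    (cell m v i)%:R <= (v 0 i + 1) / 2 * m%:R < (cell m v i)%:R + 1.
  move=> /bound/andP[b0 b1]; rewrite /cell ffunE inordK.
    by rewrite natr1; exact: truncn_itv.
  rewrite truncn_lt_nat//; apply: le_lt_trans b1 _; by rewrite ltr_nat.
move: (itv _ ul) (itv _ ul'); rewrite cc !mxE => /andP[a b] /andP[c d].
rewrite ler_norml; apply/andP; split.
  by rewrite -mulNr ler_pdivrMr//; lra.
by rewrite ler_pdivlMr//; lra.
Qed.

(** The code consists of directions of points selected from a sparse set.  The
    selection keeps few points in each of the finitely many cones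
    s' |x| <= <x, r>, where [r] represents a cell of the sphere; as
    [s' < s], such a cone contains every cap {x | <l, x> > s |x|} with [l] in
    the cell of [r].  Two points are in conflict if one of them lies in the
    double cone around the other. *)
Lemma exists_code N m (s s' sigma : R) : (0 < n)%N -> (0 < m)%N ->
  0 < s' -> 2 * s' ^+ 2 <= 1 ->
  Num.sqrt (1 - s' ^+ 2) < sigma -> sigma <= 1 ->
  n%:R * (2 / m%:R) <= s - s' -> 4 * sigma ^+ n * N%:R <= 1 ->
  exists x : 'I_N -> 'rV[R]_n,
    [/\ forall i, unit_vector (x i),
        forall i j, i != j -> `|dotv (x i) (x j)| <= s &
        forall l, unit_vector l ->
          (2 ^ #|[set i | (s < dotv l (x i))%R]%SET| <= 2 * m.+1 ^ n)%N].
Proof.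
move=> n0 m0 s'0 s'2 sig sig1 nm Np.
have ms : s' <= s.
  by rewrite -subr_ge0; apply: le_trans nm; rewrite mulr_ge0 ?divr_ge0.
have sq0 : 0 < Num.sqrt (1 - s' ^+ 2) by rewrite sqrtr_gt0; lra.
have [k [c [M [Om [M0 Om0 OmM Oms]]]]] := exists_sparse_set n0 sq0 sig sig1.
pose v (z : {ffun 'I_n -> 'I_k}) : 'rV[R]_n := grid_point z - c.
pose u z := (enorm (v z))^-1 *: v z.
pose cone l : {set {ffun 'I_n -> 'I_k}} :=
  [set z | s' * enorm (v z) <= dotv (v z) l]%SET.
have cone_le l : unit_vector l -> #|Om :&: cone l|%:R <= sigma ^+ n * #|Om|%:R.
  move=> ul; apply: le_trans (Oms (c + (s' * M) *: l)); rewrite ler_nat.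
  apply/subset_leq_card/fintype.subsetP => z; rewrite !inE => /andP[zOm zl].
  rewrite zOm opprD addrA; apply: cone_sub_ball => //; first exact: ltW.
  exact: OmM.
pose e : 'rV[R]_n := delta_mx 0 (Ordinal n0).
pose rep (i : {ffun 'I_n -> 'I_m.+1}) :=
  xget e [set l | unit_vector l /\ cell m l = i].
have rep_unit i : unit_vector (rep i).
  by rewrite /rep; case: xgetP => [_ -> []//|_]; apply: unit_delta_mx.
have rep_cell l : unit_vector l -> cell m (rep (cell m l)) = cell m l.
  by move=> ul; rewrite /rep; case: xgetP => [_ -> []//|/(_ l)[]].
(* The centre of the ball has no direction and must not be selected. *)
pose Z : {set {ffun 'I_n -> 'I_k}} := [set z | v z == 0]%SET.
pose conf z := cone (u z) :|: cone (- u z).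
have p0 : 0 <= sigma ^+ n by rewrite exprn_ge0// ltW// (lt_trans sq0).
have Z_le : #|Om :&: Z|%:R <= sigma ^+ n * #|Om|%:R.
  apply: le_trans (cone_le _ (rep_unit (cell m 0))).
  rewrite ler_nat; apply/subset_leq_card/finset.setIS/fintype.subsetP => z.
  by rewrite !inE => /eqP->; rewrite enorm0 mulr0 dotv0l.
have conf_le z : z \in Om :\: Z ->
    #|Om :&: conf z|%:R <= 2 * sigma ^+ n * #|Om|%:R.
  rewrite !inE => /andP[vz _].
  apply: (@le_trans _ _ (#|Om :&: cone (u z)|%:R + #|Om :&: cone (- u z)|%:R)).
    by rewrite -natrD ler_nat finset.setIUr leq_card_setU.
  rewrite -mulrA mulr_natl mulr2n lerD// cone_le//; first exact: unit_normalize.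
  by rewrite /unit_vector enormN; apply: unit_normalize.
have [t [tN tOm tp tc]] := greedy_selection Om0 p0
  (fun i => cone_le _ (rep_unit i)) Z_le conf_le Np.
have /card_gt0P[z0 _] := Om0.
pose zz (i : 'I_N) := nth z0 t i.
have zzt i : zz i \in t by rewrite mem_nth// tN.
have zv i : v (zz i) != 0.
  by have /allP/(_ _ (zzt i)) := tOm; rewrite /= !inE => /andP[].
have zu i : unit_vector (u (zz i)) by apply: unit_normalize.
have sep (i j : 'I_N) : (i < j)%N -> `|dotv (u (zz i)) (u (zz j))| <= s.
  move=> ij; move/(pairwiseP z0)/(_ i j): tp; rewrite !inE tN !ltn_ord.
  move=> /(_ isT isT ij); rewrite -/(zz i) -/(zz j) !negb_or -!ltNge.
  have vp : 0 < enorm (v (zz i)).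
    rewrite lt_neqAle enorm_ge0 andbT eq_sym; apply: contra_neq (zv i).
    exact: enorm_eq0.
  rewrite dotvNr => /andP[a b]; rewrite dotvZl mulrC ler_norml.
  rewrite ler_pdivrMr// ler_pdivlMr//.
  have := ler_wpM2r (ltW vp) ms.
  by move=> h; apply/andP; split; lra.
exists (fun i => u (zz i)); split=> // [i j|l ul].
  rewrite neq_lt => /orP[/sep//|/sep]; by rewrite dotvC.
apply: leq_trans (_ : _ <= 2 * #|{ffun 'I_n -> 'I_m.+1}|)%N _; last first.
  by rewrite card_ffun !card_ord.
apply: leq_trans (tc (cell m l)); rewrite leq_exp2l//.
rewrite -sum1_count (big_nth z0) big_mkord tN sum1dep_card.
apply/subset_leq_card/fintype.subsetP => i; rewrite !inE => li.
have ur := rep_unit (cell m l).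
have lr : dotv (l - rep (cell m l)) (u (zz i)) <= s - s'.
  apply: le_trans (dotv_le_enorm _ _) _; rewrite zu mulr1.
  by apply: le_trans nm; apply: cell_close => //; rewrite rep_cell.
have vp : 0 < enorm (v (zz i)).
  rewrite lt_neqAle enorm_ge0 andbT eq_sym; apply: contra_neq (zv i).
  exact: enorm_eq0.
rewrite -ler_pdivlMr// dotvC mulrC -dotvZr.
move: lr; rewrite dotvDl dotvNl; lra.
Qed.

End Code.

(** * Maximal sets of given diameter have constant width *)

Section Topology.
Context {R : realType} {n : nat}.
Implicit Types x u : 'rV[R]_n.

Lemma norm_le_enorm x : `|x| <= enorm x.
Proof.
rewrite /Num.norm/= mx_normrE; apply/bigmax_leP; split=> [|[i j] _ /=].
  exact: enorm_ge0.
by rewrite ord1 coord_le_enorm.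
Qed.

Lemma enorm_le_norm x : enorm x <= n%:R * `|x|.
Proof.
apply: enorm_le_coord => // i; rewrite [leRHS]/Num.norm/= mx_normrE.
by apply/bigmax_geP; right; exists (0, i).
Qed.

Lemma interior_enormP (B : set 'rV[R]_n) x : (0 < n)%N ->
  interior B x <->
  exists2 r : R, 0 < r & forall y, enorm (y - x) <= r -> B y.
Proof.
move=> n0; split=> [/nbhs_ballP[r /= r0 rB]|[r r0 rB]].
  exists (r / 2) => [|y yx]; first by rewrite divr_gt0.
  apply: rB; rewrite mx_norm_ball /ball_/= distrC.
  by apply: le_lt_trans (norm_le_enorm _) _; apply: le_lt_trans yx _; lra.
apply/nbhs_ballP; exists (r / n%:R) => /=; first by rewrite divr_gt0 ?ltr0n.
move=> y; rewrite mx_norm_ball /ball_/= distrC => yx; apply: rB.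
apply: le_trans (enorm_le_norm _) _; rewrite mulrC -ler_pdivlMr ?ltr0n//.
exact: ltW.
Qed.

Lemma lipschitz_enorm_continuous (f : 'rV[R]_n -> R) (k : R) : (0 < n)%N ->
  0 < k -> (forall x y, `|f x - f y| <= k * enorm (x - y)) -> continuous f.
Proof.
move=> n0 k0 fk x; apply/(@cvgrPdist_le _ _ _ (nbhs x) (nbhs_filter x)) => e e0.
suff : interior [set y | `|f x - f y| <= e] x by [].
apply/interior_enormP => //; exists (e / k) => [|y yx]; first exact: divr_gt0.
by apply: le_trans (fk x y) _; rewrite enormB mulrC -ler_pdivlMr.
Qed.

Lemma dotv_continuous u : (0 < n)%N -> continuous (dotv u).
Proof.
move=> n0; apply: (@lipschitz_enorm_continuous _ (enorm u + 1)) => // [|x y].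
  by rewrite ltr_wpDl ?enorm_ge0.
rewrite -dotvNr -dotvDr.
apply: (@le_trans _ _ (enorm u * enorm (x - y))).
  rewrite ler_norml dotv_le_enorm andbT lerNl -dotvNl.
  by rewrite (le_trans (dotv_le_enorm _ _))// enormN.
by rewrite ler_wpM2r ?enorm_ge0// lerDl.
Qed.

Lemma closed_enorm_ball x (r : R) : (0 < n)%N ->
  closed [set z | enorm (z - x) <= r].
Proof.
move=> n0; rewrite (_ : mkset _ = (fun z => enorm (z - x)) @^-1` [set y | y <= r])//.
apply: preimage_closed; last exact: closed_le.
move=> y _; move: y.
apply: (@lipschitz_enorm_continuous _ 1) => // y z; rewrite mul1r.
have le (a b : 'rV[R]_n) : enorm (a - x) - enorm (b - x) <= enorm (a - b).
  by rewrite lerBlDr -[a in enorm (a - x)](subrK b) -addrA enormD.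
by rewrite ler_norml le lerNl opprB enormB le.
Qed.

End Topology.

Section Completion.
Context {R : realType} {n : nat}.
Implicit Types (x y z p u v : 'rV[R]_n) (A B C : set 'rV[R]_n) (w : R).

Definition diam_le w B := forall x y, B x -> B y -> enorm (x - y) <= w.

(** Equivalently, [C] is maximal among the sets of diameter at most [w]. *)
Definition diam_complete w C :=
  diam_le w C /\ forall z, (forall x, C x -> enorm (z - x) <= w) -> C z.

(** In Zorn's lemma, the property that [A `|` B] has diameter at most [w]
    is used instead of the one that [B] contains [A], because it also holds for
    the union of the empty chain. *)
Lemma exists_completion w A : 0 <= w -> diam_le w A ->
  exists2 C, diam_complete w C & A `<=` C.
Proof.
move=> w0 Aw.
have [F FP Ftot|C [CP Cmax]] :=
  @Zorn_bigcup _ [set B | diam_le w (A `|` B)].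
  have FAw X x y : F X -> (A `|` X) x -> (A `|` X) y -> enorm (x - y) <= w.
    by move=> FX; apply: FP.
  move=> x y [Ax|[X FX Xx]] [Ay|[Y FY Yy]].
  - exact: Aw.
  - by apply: (FAw Y) => //; [left|right].
  - by apply: (FAw X) => //; [right|left].
  - have [XY|YX] := Ftot _ _ FX FY.
      by apply: (FAw Y) => //; right => //; apply: XY.
    by apply: (FAw X) => //; right => //; apply: YX.
exists (A `|` C); last by move=> x; left.
split=> // z zw; apply: contrapT => nz.
apply: (Cmax (C `|` [set z])).
  split=> [x|/(_ z) Cz]; first by left.
  by apply: nz; right; apply: Cz; right.
have zz : enorm (z - z) <= w by rewrite subrr enorm0.
move=> x y; rewrite setUA => -[Cx|->] [Cy|->] //.
- exact: CP.
- by rewrite enormB; apply: zw.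
- exact: zw.
Qed.

(** By maximality, [C] contains the intersection of all balls of radius [w]
    that contain [p] and [z].  If [c] is the centre of such a ball, then the
    point [q] that divides the segment from [p] to [z] in the ratio [a] satisfies
    |q - c|^2 <= w^2 - a (1 - a) |z - p|^2, which leaves room for a ball of
    radius a (1 - a) |z - p|^2 / (2 w) around [q].  This is the common
    source of convexity, interior points and constant width. *)
Lemma spindle_sub w C p z (a : R) v : 0 < w -> diam_complete w C -> C p -> C z ->
  0 <= a <= 1 -> enorm v <= 1 ->
  C (p + a *: (z - p) + (a * (1 - a) * dotv (z - p) (z - p) / (2 * w)) *: v).
Proof.
move=> w0 [Cw Cmax] Cp Cz /andP[a0 a1] v1; apply: Cmax => c Cc.
set d := z - p; set D := dotv d d.
pose e := c - p.
have eE : enorm e <= w by apply: Cw.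
have deE : enorm (d - e) <= w.
  by rewrite /d /e opprB addrA subrK; apply: Cw.
have D0 : 0 <= D := dotv_ge0 d.
have Dw : D <= w ^+ 2 by rewrite /D -enorm_le ?(ltW w0)//; apply: Cw.
have aa : 0 <= a * (1 - a) by rewrite mulr_ge0// subr_ge0.
set mu := _ / _.
have mu0 : 0 <= mu by apply: divr_ge0; [exact: mulr_ge0|rewrite mulr_ge0 ?ltW].
have muE : 2 * w * mu = a * (1 - a) * D by rewrite mulrC divfK// mulf_neq0 ?gt_eqF.
have muw : mu <= w.
  have : 2 * w * mu <= 2 * w * w; last by rewrite ler_pM2l// mulr_gt0.
  rewrite muE; apply: (@le_trans _ _ (1 * w ^+ 2)).
    by apply: ler_pM => //; nra.
  have := sqr_ge0 w; rewrite !expr2; lra.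
have -> : p + a *: d + mu *: v - c = (a *: d - e) + mu *: v.
  by rewrite /e opprB; apply/rowP => i; rewrite !mxE; ring.
apply: le_trans (enormD _ _) _; rewrite enormZ ger0_norm//.
apply: (@le_trans _ _ ((w - mu) + mu * 1)); last by lra.
apply: lerD; last by rewrite ler_wpM2l.
rewrite enorm_le ?subr_ge0//.
clearbody d e; move: eE deE; rewrite !enorm_le ?(ltW w0)// !dotvE.
rewrite (dotvC e d) -/D => h1 h2.
have k1 := ler_wpM2l a0 h2.
have k2 : (1 - a) * dotv e e <= (1 - a) * w ^+ 2 by rewrite ler_wpM2l// subr_ge0.
have k3 := sqr_ge0 mu.
rewrite !expr2 in k1 k2 k3 *; nra.
Qed.

(** Otherwise some [z] in [C] lies outside the ball of radius [w] around
    [p - w *: u].  The bulge in direction [u] of the spindle spanned by [p] and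
    [z] then crosses the supporting hyperplane at [p]. *)
Lemma complete_support w C p u : 0 < w -> diam_complete w C -> C p ->
  unit_vector u -> (forall x, C x -> dotv u x <= dotv u p) -> C (p - w *: u).
Proof.
move=> w0 Cc Cp u1 up; case: (Cc) => Cw Cmax; apply: Cmax => z Cz.
set d := z - p.
have -> : p - w *: u - z = - (d + w *: u).
  by apply/rowP => i; rewrite !mxE; ring.
have /unit_vectorP uu := u1; have dE : d = z - p by []; clearbody d.
rewrite enormN enorm_le ?(ltW w0)// !dotvE uu (dotvC u d) mulr1.
rewrite leNgt; apply/negP => big.
set D2 := dotv d d in big *; set b := dotv d u in big *.
have D20 : 0 <= D2 := dotv_ge0 d.
pose D := D2 + 2 * w * b.
have D0 : 0 < D by rewrite expr2 in big; rewrite /D; lra.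
have DD : 0 < D + D2 by lra.
(* The bulge at parameter [a] rises above the hyperplane iff a D2 < D. *)
pose a := D / (D + D2).
have a0 : 0 < a by rewrite divr_gt0.
have a1 : a <= 1 by rewrite ler_pdivrMr//; lra.
have aE : a * (D + D2) = D by rewrite divfK// gt_eqF.
have := up _ (@spindle_sub w C p z a u w0 Cc Cp Cz _ _).
rewrite (ltW a0) a1 u1 lexx => /(_ isT isT).
rewrite -!dE -/D2 !dotvDr !dotvZr uu mulr1 (dotvC u d) -/b.
set mu := _ / (2 * w).
have muE : 2 * w * mu = a * (1 - a) * D2 by rewrite mulrC divfK// mulf_neq0 ?gt_eqF.
move=> h; have {}h : a * b + mu <= 0 by lra.
have : 2 * w * (a * b + mu) <= 0 by rewrite pmulr_rle0// mulr_gt0.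
rewrite mulrDr muE.
have -> : 2 * w * (a * b) + a * (1 - a) * D2 = a * (D - a * D2) by rewrite /D; ring.
rewrite pmulr_rle0//; have : a * D > 0 by rewrite mulr_gt0.
lra.
Qed.

(** The supporting hyperplanes orthogonal to [u] pass through two points [p]
    and [p - w *: u] of [C], so that their distance is [w]. *)
Lemma complete_convex_body w C : (0 < n)%N -> 0 < w -> diam_complete w C ->
  C !=set0 -> convex_body C /\ constant_width C.
Proof.
move=> n0 w0 Cc [x0 Cx0]; case: (Cc) => Cw Cmax.
have Ccl : closed C.
  rewrite (_ : C = \bigcap_(x in C) [set z | enorm (z - x) <= w]).
    by apply: closed_bigI => x _; apply: closed_enorm_ball.
  apply/seteqP; split=> [z Cz x Cx|z zC]; first exact: Cw.
  by apply: Cmax => x Cx; apply: zC.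
have Ccpt : compact C.
  apply: bounded_closed_compact => //.
  exists (enorm x0 + w); split=> [|M MM x Cx]; first exact: num_real.
  apply: le_trans (norm_le_enorm _) _; apply: le_trans (ltW MM).
  rewrite -[in enorm x](subrK x0 x) addrC; apply: le_trans (enormD _ _) _.
  by rewrite lerD2l; apply: Cw.
have supp u : unit_vector u ->
    exists p, [/\ C p, forall x, C x -> dotv u x <= dotv u p & C (p - w *: u)].
  move=> u1; have C0 : C !=set0 by exists x0.
  have [|p Cp pmax] := compact_EVT_max C0 Ccpt (f := dotv u).
    by apply: continuous_subspaceT; apply: dotv_continuous.
  move/set_mem in Cp; exists p.
  have pm x : C x -> dotv u x <= dotv u p by move=> Cx; apply/pmax/mem_set.
  by split=> //; apply: complete_support.
split; last first.
  exists w => u u1; have [p [Cp pmax Cq]] := supp u u1.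
  have /unit_vectorP uu := u1.
  have qE : dotv u (p - w *: u) = dotv u p - w by rewrite !dotvE uu mulr1.
  exists [set x | dotv u x = dotv u p], [set x | dotv u x = dotv u p - w].
  split.
  - exists (dotv u p); split=> //; first by exists p.
    by left.
  - exists (dotv u p - w); split=> //; first by exists (p - w *: u).
    right=> x Cx /=; rewrite lerBlDr -lerBlDl -dotvNr -dotvDr.
    by apply: le_trans (dotv_le_enorm _ _) _; rewrite u1 mul1r; apply: Cw.
  - move=> /seteqP[/(_ p erefl) /= h _]; lra.
  - rewrite /set_distance; set S := [set _ | _ in _ & _ in _].
    have Sw : S w.
      exists p => //; exists (p - w *: u) => //.
      by rewrite opprB addrC subrK enormZ u1 mulr1 ger0_norm// ltW.
    have Slb : lbound S w.
      move=> _ [x /= xp [y /= yp <-]].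
      have -> : w = dotv u (x - y) by rewrite !dotvE xp yp; ring.
      by apply: le_trans (dotv_le_enorm _ _) _; rewrite u1 mul1r.
    apply/eqP; rewrite eq_le; apply/andP; split.
      by apply: ge_inf => //; exists w.
    by apply: lb_le_inf => //; exists w.
split=> //.
- move=> x y k /set_mem Cx /set_mem Cy; apply: mem_set.
  have := @spindle_sub w C y x k%:num 0 w0 Cc Cy Cx _ _.
  rewrite scaler0 addr0 enorm0 ler01 => h.
  have -> : conv k x y = y + k%:num *: (x - y) :> 'rV[R]_n.
    transitivity (k%:num *: x + (1 - k%:num) *: y : 'rV[R]_n) => //.
    by apply/rowP => i; rewrite !mxE; ring.
  by apply: h => //; apply/andP.
- have [p [Cp _ Cq]] := supp _ (unit_delta_mx (Ordinal n0)).
  set e := delta_mx _ _ in Cq.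
  have ee : dotv e e = 1 by apply/unit_vectorP/unit_delta_mx.
  exists (p - (w / 2) *: e); apply/interior_enormP => //.
  exists (w / 8) => [|y yx]; first by rewrite divr_gt0.
  have := @spindle_sub w C p _ (1 / 2)
    ((8 / w) *: (y - (p - (w / 2) *: e))) w0 Cc Cp Cq _ _.
  have w8 : 0 < 8 / w by rewrite divr_gt0.
  rewrite enormZ gtr0_norm//.
  have -> : p - w *: e - p = - (w *: e) by rewrite addrAC subrr add0r.
  rewrite !dotvE ee.
  have -> : 1 / 2 * (1 - 1 / 2) * - (w * - (w * 1)) / (2 * w) = w / 8.
    by field; rewrite gt_eqF.
  rewrite scalerA (_ : w / 8 * (8 / w) = 1); last by field; rewrite gt_eqF.
  rewrite scale1r.
  have -> : p + (1 / 2) *: - (w *: e) + (y - (p - (w / 2) *: e)) = y.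
    by apply/rowP => i; rewrite !mxE; field.
  apply; first by apply/andP; split; lra.
  rewrite mulrC -ler_pdivlMr//; apply: le_trans yx _.
  by rewrite mul1r invf_div.
Qed.

End Completion.

(** * From codes to bodies of constant width *)

Section Illumination.
Context {R : realType} {n : nat}.
Implicit Types (x y p l u v : 'rV[R]_n) (K : set 'rV[R]_n).

(** Moving from [p] away from [y] does not leave [K] at once. *)
Lemma interior_dist_lt K w p y : (0 < n)%N -> 0 < w -> diam_le w K ->
  interior K p -> K y -> enorm (p - y) < w.
Proof.
move=> n0 w0 Kw /(interior_enormP _ _ n0)[r r0 rK] Ky.
have Kp : K p by apply: rK; rewrite subrr enorm0 ltW.
have rw : 0 < r / w by rewrite divr_gt0.
have : K (p + (r / w) *: (p - y)).
  apply: rK; rewrite addrAC subrr add0r enormZ gtr0_norm//.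
  by rewrite mulrAC ler_pdivrMr// ler_pM2l// Kw.
move=> /Kw/(_ Ky).
have -> : p + (r / w) *: (p - y) - y = (1 + r / w) *: (p - y).
  by rewrite scalerDl scale1r addrAC.
have h : 0 < 1 + r / w by rewrite addr_gt0.
rewrite enormZ gtr0_norm// mulrC -ler_pdivlMr// => /le_lt_trans; apply.
by rewrite ltr_pdivrMr// ltr_pMr// ltrDl.
Qed.

(** An interior point [x + t *: l] satisfies
    w^2 > |x + tl - y|^2 = w^2 + 2 t <l, x - y> + t^2. *)
Lemma illuminated_dot_lt0 K w x y l : (0 < n)%N -> 0 < w -> diam_le w K ->
  K y -> enorm (x - y) = w -> unit_vector l -> illuminated_by K x l ->
  dotv l (x - y) < 0.
Proof.
move=> n0 w0 Kw Ky xy /unit_vectorP l1 [t t0 intK].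
have := interior_dist_lt n0 w0 Kw intK Ky.
rewrite enorm_lt ?(ltW w0)// -xy sqr_enorm addrAC.
move: (x - y) => d; rewrite !dotvE l1 (dotvC d l) => h.
by rewrite -(pmulr_rlt0 _ t0); have := sqr_ge0 t; rewrite expr2; lra.
Qed.

Lemma exists_unit_orthogonal x : (1 < n)%N ->
  exists2 v, unit_vector v & dotv x v = 0.
Proof.
move=> n1; have kn0 : kermx x^T != 0.
  rewrite -mxrank_eq0 mxrank_ker -lt0n subn_gt0.
  by apply: leq_ltn_trans (rank_leq_col _) n1.
have v0 := nz_row_eq0 (kermx x^T); rewrite (negPf kn0) in v0.
set v := nz_row _ in v0.
have : v *m x^T = 0 by apply/sub_kermxP; apply: nz_row_sub.
move=> /matrixP/(_ 0 0); rewrite !mxE => vx.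
exists ((enorm v)^-1 *: v); first by apply: unit_normalize; rewrite v0.
rewrite dotvZr dotvC /dotv (_ : \sum_i _ = 0) ?mulr0// -[RHS]vx.
by apply: eq_bigr => i _; rewrite mxE.
Qed.

End Illumination.

Section ApexRim.
Context {R : realType} {n : nat}.
Variables s w : R.
Implicit Types a b u v l : 'rV[R]_n.

Hypotheses (s_gt0 : 0 < s) (sE : 8 * s ^+ 2 + s = 1).
Hypotheses (w_gt0 : 0 < w) (wE : (1 + s) * w ^+ 2 = 1 - s).

Definition apex a : 'rV[R]_n := (1 - 2 * s) *: a.

Definition rim_point a v : 'rV[R]_n := (s * w) *: v - s *: a.

(** The root is about 0.297; cruder bounds suffice. *)
Lemma code_cosine_bounds : 9^-1 < s /\ s < 3^-1.
Proof. by move: s_gt0 sE; rewrite expr2; nra. Qed.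

(** With [c] = <a, b> and [d] = <a, v>, the distance increases with
    [c - w * d] and equals [w] when this is 1, as it is for [a = b].  In
    general, d^2 <= 1 - c^2 because [v] is orthogonal to [b], so that
    [c - w * d <= 1] follows from w^2 <= (1 - c) / (1 + c); the right-hand side
    decreases in [c] and equals w^2 at [c = s]. *)
Lemma apex_rim_dist a b v :
  unit_vector a -> unit_vector b -> unit_vector v -> dotv b v = 0 ->
  (a = b \/ dotv a b <= s) -> enorm (apex a - rim_point b v) <= w.
Proof.
move=> ua ub uv bv ab.
have [/unit_vectorP aa /unit_vectorP bb /unit_vectorP vv] := And3 ua ub uv.
have [s9 s3] := code_cosine_bounds.
rewrite enorm_le ?(ltW w_gt0)// /apex /rim_point !dotvE aa bb vv.
rewrite (dotvC b a) (dotvC v a) (dotvC v b) bv.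
set c := dotv a b in ab *; set d := dotv a v.
suff cd : c - w * d <= 1.
  have h : 0 <= s * (1 - 2 * s) * (1 - (c - w * d)).
    by rewrite !mulr_ge0 ?subr_ge0//; lra.
  have e1 : (1 - s) * ((1 + s) * w ^+ 2) = (1 - s) * (1 - s) by rewrite wE.
  rewrite !expr2 in e1 *; lra.
have [ab1|cs] := ab.
  by rewrite /c /d ab1 bb bv; lra.
have cs1 : c < 1 by lra.
have dd : d ^+ 2 <= 1 - c ^+ 2.
  have := Cauchy_Schwarz (a - c *: b) v.
  rewrite !dotvE aa bb vv (dotvC b a) bv -/c -/d.
  by rewrite !expr2; lra.
have wd : (w * d) ^+ 2 <= (1 - c) ^+ 2.
  rewrite exprMn; apply: (@le_trans _ _ (w ^+ 2 * (1 - c ^+ 2))).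
    by rewrite ler_wpM2l ?sqr_ge0.
  have -> : w ^+ 2 * (1 - c ^+ 2) = (1 - c) * (w ^+ 2 * (1 + c)) by ring.
  rewrite [leRHS]expr2 ler_wpM2l ?subr_ge0 ?(ltW cs1)//.
  have : 0 <= w ^+ 2 * (s - c) by rewrite mulr_ge0 ?sqr_ge0 ?subr_ge0.
  by move: wE; set W := w ^+ 2; lra.
have : `|w * d| <= 1 - c.
  rewrite -(@ler_pXn2r _ 2) ?nnegrE ?subr_ge0 ?(ltW cs1)//.
  by rewrite real_normK ?num_real.
by rewrite ler_norml; lra.
Qed.

Lemma apex_rim_dist_eq a v : unit_vector a -> unit_vector v ->
  dotv a v = 0 -> enorm (apex a - rim_point a v) = w.
Proof.
move=> /unit_vectorP aa /unit_vectorP vv av.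
have w2 : enorm (apex a - rim_point a v) ^+ 2 = w ^+ 2.
  rewrite sqr_enorm /apex /rim_point !dotvE aa vv (dotvC v a) av.
  have e1 : (1 - s) * ((1 + s) * w ^+ 2) = (1 - s) * (1 - s) by rewrite wE.
  rewrite !expr2 in e1 *; lra.
apply/eqP; rewrite -(@eqrXn2 _ 2) ?enorm_ge0 ?(ltW w_gt0)//.
exact/eqP.
Qed.

(** The worst case is <a, b> = -s.  There (1 - 2s)(1 + s) = 3 (1 - s) / 4
    reduces the claim to 1 <= 9 s. *)
Lemma apex_dist a b : unit_vector a -> unit_vector b ->
  (a = b \/ - s <= dotv a b) -> enorm (apex a - apex b) <= w.
Proof.
move=> /unit_vectorP aa /unit_vectorP bb [<-|ab].
  by rewrite subrr enorm0 ltW.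
have [s9 s3] := code_cosine_bounds.
rewrite enorm_le ?(ltW w_gt0)// /apex !dotvE aa bb (dotvC b a).
have s1 : 0 < 1 + s by lra.
rewrite -(ler_pM2l s1) wE.
set c := dotv a b in ab *.
have h : 0 <= (1 + s) * (1 - 2 * s) * (1 - 2 * s) * (c + s).
  by rewrite !mulr_ge0//; lra.
have e : (1 - 2 * s) * (1 + s) = 3 / 4 * (1 - s) by move: sE; rewrite expr2; lra.
apply: (@le_trans _ _ (2 * ((1 - 2 * s) * (1 + s)) * ((1 - 2 * s) * (1 + s)))).
  lra.
rewrite e; have : 0 <= (1 - s) * (9 * s - 1) by rewrite mulr_ge0; lra.
lra.
Qed.

(** This is where 8 s^2 + s = 1 comes from: it makes the norm exactly [w / 2],
    so that any two rim points, of whichever vectors, are close enough. *)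
Lemma rim_point_norm a v : unit_vector a -> unit_vector v -> dotv a v = 0 ->
  enorm (rim_point a v) <= w / 2.
Proof.
move=> /unit_vectorP aa /unit_vectorP vv av.
rewrite enorm_le ?divr_ge0 ?(ltW w_gt0)// /rim_point !dotvE aa vv (dotvC v a) av.
have s1 : 0 < 1 + s by have := s_gt0; lra.
rewrite -(ler_pM2l s1).
have e1 : s ^+ 2 * ((1 + s) * w ^+ 2) = s ^+ 2 * (1 - s) by rewrite wE.
by move: e1 wE sE; rewrite !expr2; lra.
Qed.

(** The strongest condition comes from the [v] opposite to the component [g]
    of [l] orthogonal to [a].  It says (1 - s) c < - s w |g| with c = <l, a>
    and |g|^2 = 1 - c^2, which amounts to c < 0 and c^2 > s^2. *)
Lemma cap_of_rim_directions a l : (1 < n)%N -> unit_vector a -> unit_vector l ->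
  (forall v, unit_vector v -> dotv a v = 0 ->
    dotv l (apex a - rim_point a v) < 0) -> dotv l a < - s.
Proof.
move=> n1 /unit_vectorP aa /unit_vectorP ll rims.
have [s9 s3] := code_cosine_bounds.
pose c := dotv l a; pose g := l - c *: a.
have ag : dotv a g = 0 by rewrite /g !dotvE aa (dotvC a l) -/c; ring.
have gg : enorm g ^+ 2 = 1 - c ^+ 2.
  by rewrite sqr_enorm /g !dotvE aa ll (dotvC a l) -/c expr2; ring.
have lg : dotv l g = enorm g ^+ 2.
  by rewrite gg /g !dotvE ll -/c expr2; ring.
have rimE v : dotv l (apex a - rim_point a v) = (1 - s) * c - s * w * dotv l v.
  by rewrite /apex /rim_point !dotvE -/c; ring.
rewrite -/c; have [g0|g0] := eqVneq g 0.
  have [v v1 av] := exists_unit_orthogonal a n1.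
  have := rims v v1 av; rewrite rimE.
  have -> : dotv l v = 0.
    have -> : l = c *: a by apply/eqP; rewrite -subr_eq0 -/g g0.
    by rewrite dotvZl av mulr0.
  rewrite mulr0 subr0 pmulr_rlt0; last by lra.
  move: gg; rewrite g0 enorm0 expr0n/= expr2 => cc c0; nra.
have gp : 0 < enorm g.
  rewrite lt_neqAle enorm_ge0 andbT eq_sym; apply: contra_neq g0.
  exact: enorm_eq0.
have := rims (- ((enorm g)^-1 *: g)).
rewrite rimE !dotvNr !dotvZr ag mulr0 oppr0 lg expr2 mulKf ?gt_eqF// => h.
have {}h : (1 - s) * c + s * w * enorm g < 0.
  have := h _ erefl; rewrite mulrN opprK; apply.
  by rewrite /unit_vector enormN; apply: unit_normalize.
have swg : 0 < s * w * enorm g by rewrite !mulr_gt0.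
have c0 : c < 0.
  have : (1 - s) * c < 0 by lra.
  by rewrite pmulr_rlt0//; lra.
have sq : (s * w * enorm g) ^+ 2 < ((1 - s) * c) ^+ 2.
  by rewrite -(sqrrN (_ * c)) ltr_pXn2r// ?nnegrE; lra.
rewrite !exprMn gg in sq.
have s1 : 0 < 1 + s by lra.
have s1' : 0 < 1 - s by lra.
rewrite -(ltr_pM2l s1) in sq.
have e : (1 + s) * (s ^+ 2 * w ^+ 2 * (1 - c ^+ 2)) =
  (1 - s) * (s ^+ 2 * (1 - c ^+ 2)) by rewrite -wE; ring.
have e' : (1 + s) * ((1 - s) ^+ 2 * c ^+ 2) = (1 - s) * ((1 - s ^+ 2) * c ^+ 2).
  by ring.
rewrite e e' ltr_pM2l// in sq.
have {}sq : s ^+ 2 < (- c) ^+ 2 by rewrite sqrrN; lra.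
by move: sq; rewrite ltr_pXn2r ?nnegrE//; lra.
Qed.

End ApexRim.

Section BodyOfCode.
Context {R : realType} {n N : nat}.
Variables (s : R) (x : 'I_N -> 'rV[R]_n).
Hypotheses (n_gt1 : (1 < n)%N) (s_gt0 : 0 < s) (sE : 8 * s ^+ 2 + s = 1).
Hypothesis x1 : forall i, unit_vector (x i).
Hypothesis xx : forall i j, i != j -> `|dotv (x i) (x j)| <= s.

Lemma exists_constant_width_of_code : (0 < N)%N ->
  exists K : set 'rV[R]_n, [/\ convex_body K, constant_width K &
    exists y : 'I_N -> 'rV[R]_n,
      (forall i, (closure K `\` interior K) (y i)) /\
      forall i l, unit_vector l -> illuminated_by K (y i) l ->
        s < dotv (- l) (x i)].
Proof.
move=> N0; have n0 := ltnW n_gt1.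
have [s9 s3] := code_cosine_bounds s_gt0 sE.
pose w := Num.sqrt ((1 - s) / (1 + s)).
have q0 : 0 < (1 - s) / (1 + s) by rewrite divr_gt0; lra.
have w0 : 0 < w by rewrite sqrtr_gt0.
have wE : (1 + s) * w ^+ 2 = 1 - s.
  by rewrite sqr_sqrtr ?(ltW q0)// mulrC divfK// gt_eqF//; lra.
pose rim i := [set rim_point s w (x i) v | v in
  [set v | unit_vector v /\ dotv (x i) v = 0]].
pose A : set 'rV[R]_n := range (fun i => apex s (x i)) `|` \bigcup_i rim i.
have xc i j : x i = x j \/ - s <= dotv (x i) (x j) <= s.
  have [->|/xx] := eqVneq i j; first by left.
  by rewrite ler_norml; right.
have ar i j v : unit_vector v -> dotv (x j) v = 0 ->
    enorm (apex s (x i) - rim_point s w (x j) v) <= w.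
  move=> v1 xv; apply: apex_rim_dist => //.
  by have [|/andP[_ h]] := xc i j; [left|right].
have Aw : diam_le w A.
  move=> _ _ [[i _ <-]|[i _ [v [v1 iv] <-]]] [[j _ <-]|[j _ [u [u1 ju] <-]]].
  - apply: apex_dist => //.
    by have [|/andP[h _]] := xc i j; [left|right].
  - exact: ar.
  - by rewrite enormB; apply: ar.
  - apply: le_trans (enormD _ _) _; rewrite enormN [leRHS](splitr w).
    by apply: lerD; apply: rim_point_norm.
have [K Kc AK] := exists_completion (ltW w0) Aw.
have KA i : K (apex s (x i)) by apply: AK; left; exists i.
have KR i v : unit_vector v -> dotv (x i) v = 0 -> K (rim_point s w (x i) v).
  by move=> v1 iv; apply: AK; right; exists i => //; exists v.
have K0 : K !=set0 by exists (apex s (x (Ordinal N0))).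
have [Kb Kcw] := complete_convex_body n0 w0 Kc K0.
have [Kw _] := Kc.
exists K; split=> //; exists (fun i => apex s (x i)); split=> [i|i l l1 il].
  split; first exact: subset_closure.
  have [v v1 iv] := exists_unit_orthogonal (x i) n_gt1.
  move=> /(interior_dist_lt n0 w0 Kw)/(_ (KR i v v1 iv)).
  by rewrite apex_rim_dist_eq// ltxx.
rewrite dotvNl ltrNr; apply: (@cap_of_rim_directions _ _ s w) => // v v1 iv.
apply: (illuminated_dot_lt0 n0 w0 Kw) il => //; first exact: KR.
exact: apex_rim_dist_eq.
Qed.

End BodyOfCode.

(** Each direction illuminates at most [k] of the [N] points, so that [N] is
    at most [k] times the number of directions. *)
Lemma illumination_number_ge (R : realType) (n N k : nat)
    (K : set 'rV[R]_n) (y : 'I_N -> 'rV[R]_n) (t : R) :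
  t * k%:R <= N%:R -> (0 < k)%N ->
  (forall i, (closure K `\` interior K) (y i)) ->
  (forall l, unit_vector l ->
    exists2 B : {set 'I_N}, (#|B| <= k)%N &
      forall i, illuminated_by K (y i) l -> i \in B) ->
  (t%:E <= illumination_number K)%E.
Proof.
move=> tk k0 yK lk; apply/ereal_infP => _ [L [L1 LK] <-].
rewrite /counting; case: asboolP => [Lfin|_]; last exact: leey.
rewrite lee_fin -(ler_pM2r (_ : 0 < k%:R)) ?ltr0n//.
apply: le_trans tk _; rewrite -natrM ler_nat.
pose F := fset_set L.
have /choice[f fP] : forall i, exists l : F, illuminated_by K (y i) (val l).
  move=> i; have [l Ll il] := LK _ (yK i).
  have lF : l \in F by rewrite in_fset_set//; apply: mem_set.
  by exists [` lF]%fset.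
rewrite -[N in (N <= _)%N]card_ord -sum1_card (partition_big f xpredT)//=.
rewrite cardfE -sum_nat_const; apply: leq_sum => l _; rewrite sum1dep_card.
have ul : unit_vector (val l).
  by apply: L1; have := valP l; rewrite in_fset_set// => /set_mem.
have [B Bk BP] := lk _ ul.
apply: leq_trans Bk; apply/subset_leq_card/fintype.subsetP => i.
by rewrite inE => /eqP fi; apply: BP; rewrite -fi.
Qed.

(** * Asymptotics *)

(** Bernoulli's inequality for the fourth root of [r] gives a bound of order
    n^4. *)
Lemma quadratic_le_exponential (R : realType) (r C : R) : 1 < r -> 0 <= C ->
  exists n0, forall n, (n0 <= n)%N -> C * (n%:R ^+ 2 + 1) <= r ^+ n.
Proof.
move=> r1 C0; pose q := Num.sqrt (Num.sqrt r).
have r0 : 0 <= r by lra.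
have qr : q ^+ 4 = r by rewrite (exprM q 2 2) !sqr_sqrtr ?sqrtr_ge0.
have sqrt1 (x : R) : 1 < x -> 1 < Num.sqrt x.
  by move=> x1; rewrite -{1}sqrtr1 ltr_sqrt//; lra.
have q1 : 1 < q by apply/sqrt1/sqrt1.
pose h := q - 1; have h0 : 0 < h by rewrite subr_gt0.
exists (Num.truncn (2 * C / h ^+ 3)).+1 => n n0n.
have nC : 2 * C <= n%:R * h ^+ 3.
  rewrite -ler_pdivrMr ?exprn_gt0//; apply: ltW.
  by apply: lt_le_trans (truncnS_gt _) _; rewrite ler_nat.
have n1 : (1 : R) <= n%:R by rewrite ler1n (leq_trans _ n0n).
have nh : 0 <= n%:R * h by rewrite mulr_ge0// ltW.
rewrite -qr -exprM mulnC exprM.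
apply: (@le_trans _ _ ((1 + n%:R * h) ^+ 4)); last first.
  rewrite ler_pXn2r ?nnegrE ?addr_ge0//; last first.
    by rewrite exprn_ge0// sqrtr_ge0.
  have -> : q = 1 + h by rewrite /h; ring.
  exact: Bernoulli (ltW h0).
apply: (@le_trans _ _ ((1 + n%:R * h) ^+ 3)); last first.
  by rewrite ler_weXn2l// lerDl.
apply: (@le_trans _ _ ((n%:R * h) ^+ 3)); last first.
  by rewrite ler_pXn2r ?nnegrE ?addr_ge0// lerDr.
apply: (@le_trans _ _ (2 * C * n%:R ^+ 2)).
  rewrite mulrAC mulrC ler_wpM2r//; have : 1 <= n%:R ^+ 2 :> R by rewrite exprn_ege1.
  lra.
have -> : (n%:R * h) ^+ 3 = n%:R * h ^+ 3 * n%:R ^+ 2 by ring.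
by rewrite ler_wpM2r ?exprn_ge0.
Qed.

Section Asymptotics.
Context {R : realType}.

Definition critical_cosine : R := (Num.sqrt 33 - 1) / 16.

Local Notation s0 := critical_cosine.

Let sqr_sqrt33 : Num.sqrt 33 ^+ 2 = 33 :> R. Proof. by rewrite sqr_sqrtr. Qed.

Let sqrt33_gt : 5 < Num.sqrt 33 :> R.
Proof.
by rewrite -(@ltr_pXn2r _ 2) ?nnegrE ?sqrtr_ge0// sqr_sqrt33 -natrX ltr_nat.
Qed.

Let sqrt33_lt : Num.sqrt 33 < 6 :> R.
Proof.
by rewrite -(@ltr_pXn2r _ 2) ?nnegrE ?sqrtr_ge0// sqr_sqrt33 -natrX ltr_nat.
Qed.

Lemma critical_cosine_gt0 : 0 < s0.
Proof. by have := sqrt33_gt; rewrite /critical_cosine; lra. Qed.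

Lemma critical_cosineE : 8 * s0 ^+ 2 + s0 = 1.
Proof.
by have := sqr_sqrt33; rewrite /critical_cosine !expr2; lra.
Qed.

(** This is (111 - sqrt 33) (111 + sqrt 33) = 96 * 128, as
    1 - s0^2 = (111 + sqrt 33) / 128. *)
Lemma sqr_tau : tau R ^+ 2 * (1 - s0 ^+ 2) = 1.
Proof.
rewrite /tau exprMn sqr_sqrtr; last by have := sqrt33_lt; lra.
have := sqr_sqrt33; rewrite /critical_cosine; set q := Num.sqrt 33 => qq.
have -> : 1 - ((q - 1) / 16) ^+ 2 = (111 + q) / 128.
  by rewrite expr2 in qq; rewrite expr2; lra.
by rewrite expr2 in qq; rewrite expr2; lra.
Qed.

Lemma tau_gt1 : 1 < tau R.
Proof.
have t0 : 0 <= tau R by rewrite mulr_ge0 ?sqrtr_ge0.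
rewrite -(@ltr_pXn2r _ 2) ?nnegrE// expr1n.
have := sqr_tau; have := critical_cosine_gt0; have := critical_cosineE.
rewrite !expr2; nra.
Qed.

Definition body_illumination_ge n (t : R) := exists K : set 'rV[R]_n,
  [/\ convex_body K, constant_width K & ((t ^+ n)%:E <= illumination_number K)%E].

Lemma body_illumination_ge_le n (t t' : R) : 0 <= t -> t <= t' ->
  body_illumination_ge n t' -> body_illumination_ge n t.
Proof.
move=> t0 tt' [K [Kb Kw Ki]]; exists K; split=> //.
by apply: le_trans Ki; rewrite lee_fin lerXn2r// nnegrE// (le_trans t0).
Qed.

Lemma body_illumination_ge0 n : (0 < n)%N -> body_illumination_ge n 0.
Proof.
move=> n0; have [|K Kc zK] := @exists_completion R n 1 [set 0] ler01.
  by move=> _ _ -> ->; rewrite subrr enorm0.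
have K0 : K !=set0 by exists 0; apply: zK.
have [Kb Kw] := complete_convex_body n0 ltr01 Kc K0.
exists K; split=> //; rewrite expr0n gtn_eqF//.
apply/ereal_infP => _ [L _ <-].
by rewrite /counting; case: ifP; rewrite ?lee_fin ?leey.
Qed.

(** With t < t' < tau, the code has about t'^n / 4 vectors, and by the choice of
    [2 ^ n] intervals per coordinate for the net, a cap contains at most
    n^2 + 1 of them; (t' / t)^n outgrows this polynomial. *)
Lemma body_illumination_ge_lt_tau (t : R) : 0 <= t -> t < tau R ->
  exists n0, forall n, (n0 <= n)%N -> body_illumination_ge n t.
Proof.
move=> t0 ttau; wlog t1 : t t0 ttau / 1 <= t.
  move=> wl; have [t1|t1] := leP 1 t; first exact: wl.
  have [n0 n0P] := wl 1 ler01 tau_gt1 (lexx 1).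
  by exists n0 => n /n0P; apply: body_illumination_ge_le => //; exact: ltW.
pose t' := (t + tau R) / 2.
have tt' : t < t' by rewrite /t'; lra.
have t'tau : t' < tau R by rewrite /t'; lra.
have t'0 : 0 < t' by lra.
have tau0 : 0 < tau R by have := tau_gt1; lra.
have s00 := critical_cosine_gt0; have s0e := critical_cosineE.
have tau2 : tau R ^- 2 = 1 - s0 ^+ 2.
  apply: (@mulfI _ (tau R ^+ 2)); first by rewrite expf_neq0 ?gt_eqF.
  by rewrite sqr_tau divff// expf_neq0 ?gt_eqF.
have t'2 : tau R ^- 2 < t' ^- 2.
  by rewrite ltf_pV2 ?posrE ?exprn_gt0// ltr_pXn2r// nnegrE ltW.
have t'2' : t' ^- 2 <= 1 by rewrite invf_le1 ?exprn_gt0// exprn_ege1//; lra.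
(* [s'] lies strictly between sqrt (1 - t'^-2) and sqrt (1 - tau^-2) = s0. *)
pose V := (tau R ^- 2 + t' ^- 2) / 2.
pose s' := Num.sqrt (1 - V).
have V1 : V < 1 by rewrite /V; lra.
have s'2 : s' ^+ 2 = 1 - V by rewrite sqr_sqrtr//; lra.
have s'0 : 0 < s' by rewrite sqrtr_gt0; lra.
have s's : s' < s0.
  rewrite -(@ltr_pXn2r _ 2) ?nnegrE ?(ltW s'0) ?(ltW s00)// s'2.
  by move: tau2 t'2; rewrite /V; set a := _ ^- 2; set b := _ ^- 2; lra.
have s'h : 2 * s' ^+ 2 <= 1.
  by rewrite s'2 /V; move: s0e tau2 t'2; set a := _ ^- 2; set b := _ ^- 2; lra.
have sig : Num.sqrt (1 - s' ^+ 2) < t'^-1.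
  have -> : t'^-1 = Num.sqrt (t' ^- 2).
    by rewrite -exprVn sqrtr_sqr ger0_norm// invr_ge0 ltW.
  by rewrite s'2 ltr_sqrt ?invr_gt0 ?exprn_gt0// /V; lra.
have sig1 : t'^-1 <= 1 by rewrite invf_le1//; lra.
have del0 : 0 < s0 - s' by rewrite subr_gt0.
have [n1 n1P] : exists n1, forall n, (n1 <= n)%N ->
    2 / (s0 - s') * (n%:R ^+ 2 + 1) <= 2 ^+ n.
  by apply: quadratic_le_exponential; rewrite ?divr_ge0 ?ltr1n// ltW.
have [n2 n2P] : exists n2, forall n, (n2 <= n)%N ->
    8 * (n%:R ^+ 2 + 1) <= (t' / t) ^+ n.
  by apply: quadratic_le_exponential; rewrite ?ltr_pdivlMr ?mul1r//; lra.
exists (maxn 2 (maxn n1 n2)) => n; rewrite !geq_max => /and3P[n_gt1 nn1 nn2].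
have n0 : (0 < n)%N by apply: ltnW.
pose m := (2 ^ n).-1; pose N := Num.truncn (t' ^+ n / 4).
have mS : m.+1 = (2 ^ n)%N by rewrite prednK// expn_gt0.
have mR : m%:R = 2 ^+ n - 1 :> R by rewrite -natrX -mS -natr1 addrK.
have m0 : (0 < m)%N by rewrite -ltnS mS -[1%N](expn0 2) ltn_exp2l.
have mbound : n%:R * (2 / m%:R) <= s0 - s'.
  rewrite mulrA ler_pdivrMr ?ltr0n// mR mulrBr mulr1.
  have := n1P _ nn1; rewrite mulrAC ler_pdivrMr// => h.
  have s01 : s0 - s' <= 1 by have := sqr_ge0 s0; move: s0e s'0; lra.
  have nn : (0 : R) <= n%:R ^+ 2 by rewrite exprn_ge0.
  have := sqr_ge0 (n%:R - 1 : R); rewrite !expr2 in h nn *; lra.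
have tn0 : 0 < t' ^+ n / 4 by rewrite divr_gt0 ?exprn_gt0.
have /andP[N_le N_gt] := truncn_itv (ltW tn0).
have Nbound : 4 * t'^-1 ^+ n * N%:R <= 1.
  rewrite exprVn -mulrA mulrCA -ler_pdivlMl ?invr_gt0 ?exprn_gt0// invrK mulr1.
  by rewrite mulrC -ler_pdivlMr.
have tk : t ^+ n * (n ^ 2).+1%:R <= N%:R.
  have tn1 : 1 <= t ^+ n by rewrite exprn_ege1.
  have := n2P _ nn2; rewrite expr_div_n ler_pdivlMr ?exprn_gt0//; last by lra.
  move: N_gt; rewrite -/N -(natr1 N) -(natr1 (n ^ 2)) natrX.
  set T := t ^+ n in tn1 *; set P := t' ^+ n; set Q := n%:R ^+ 2 => a b.
  have : 0 <= T * Q by rewrite mulr_ge0 ?sqr_ge0//; lra.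
  lra.
have [x [x1 xx xl]] :=
  exists_code n0 m0 s'0 s'h sig sig1 mbound Nbound.
have N0 : (0 < N)%N.
  rewrite -(ltr_nat R); apply: lt_le_trans tk.
  by rewrite mulr_gt0 ?ltr0n// exprn_gt0//; lra.
have [K [Kb Kw [y [yK yl]]]] :=
  exists_constant_width_of_code n_gt1 s00 s0e x1 xx N0.
exists K; split=> //; apply: (illumination_number_ge tk) yK _ => // l l1.
exists [set i | (s0 < dotv (- l) (x i))%R]%SET => [|i il]; last first.
  by rewrite inE; apply: yl.
rewrite -(@leq_exp2l 2)//; apply: leq_trans (xl (- l) _) _.
  by rewrite /unit_vector enormN.
by rewrite mS -expnM -expnS mulnn.
Qed.

(** The error at [n] is the infimum of the [d] such that [Q n (T - d)], enlarged
    by 1 / (n + 1) because the infimum need not be attained, and cut off at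
    [T], where [Q n 0] takes over. *)
Lemma exists_vanishing_error (Q : nat -> R -> Prop) (T : R) : 0 < T ->
  (forall n t t', 0 <= t -> t <= t' -> Q n t' -> Q n t) ->
  (forall n, (0 < n)%N -> Q n 0) ->
  (forall t, 0 <= t -> t < T ->
    exists n0, forall n, (n0 <= n)%N -> Q n t) ->
  exists eps : nat -> R, eps n @[n --> \oo] --> (0 : R) /\
    forall n, (0 < n)%N -> Q n (T + eps n).
Proof.
move=> T0 Qle Q0 Qlim.
pose S n := [set d | 0 <= d <= T /\ Q n (T - d)].
have Slb n : lbound (S n) 0 by move=> d [/andP[]].
pose e n := Num.min (inf (S n) + n.+1%:R^-1) T.
exists (fun n => - e n); split; last first.
  move=> n n0; have ST : S n T by split; [rewrite lexx ltW|rewrite subrr; apply: Q0].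
  have Sinf : has_inf (S n) by split; [exists T|exists 0].
  have [|d [/andP[d0 dT] Qd] de] := inf_adherent (_ : 0 < n.+1%:R^-1 :> R) Sinf.
    by rewrite invr_gt0 ltr0n.
  have [eT|eT] := leP T (inf (S n) + n.+1%:R^-1).
    by rewrite /e min_r// subrr; apply: Q0.
  rewrite /e min_l ?(ltW eT)//; move: (inf _ + _) eT de => r rT dr.
  by apply: Qle Qd; lra.
apply/cvgrPdist_le => d d0; pose c := Num.min (d / 2) (T / 2).
have c0 : 0 < c by rewrite lt_min; apply/andP; split; lra.
have [cd cT] : c <= d / 2 /\ c <= T / 2 by rewrite !ge_min !lexx orbT.
have [||n0 n0P] := Qlim (T - c); [lra|lra|].
exists (maxn n0 (Num.truncn (2 / d))) => // n /=; rewrite geq_max => /andP[nn0 nd].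
rewrite sub0r opprK ger0_norm; last first.
  rewrite le_min (ltW T0) andbT addr_ge0 ?invr_ge0//.
  have Sc : S n c by split; [apply/andP; split; lra|exact: n0P].
  by apply: lb_le_inf => //; exists c.
rewrite ge_min; apply/orP; left.
have : inf (S n) <= c.
  apply: ge_inf; first by exists 0.
  by split; [apply/andP; split; lra|exact: n0P].
have : n.+1%:R^-1 <= d / 2.
  rewrite -[d / 2]invrK lef_pV2 ?posrE ?invr_gt0 ?divr_gt0// ?ltr0n//.
  by rewrite invf_div ltW// (lt_le_trans (truncnS_gt _))// ler_nat.
by move=> n_small inf_small; rewrite (splitr d) lerD// (le_trans inf_small).
Qed.

End Asymptotics.

Theorem theorem1p4 (R : realType) :
  exists eps : nat -> R,
    eps n @[n --> \oo] --> (0 : R) /\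
    forall n : nat, (0 < n)%N ->
      exists K : set 'rV[R]_n,
        [/\ convex_body K, constant_width K &
            (((tau R + eps n) ^+ n)%:E <= illumination_number K)%E].
Proof.
apply: (@exists_vanishing_error _ (@body_illumination_ge R)).
- by have := @tau_gt1 R; lra.
- exact: body_illumination_ge_le.
- exact: body_illumination_ge0.
- exact: body_illumination_ge_lt_tau.
Qed.
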